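(* Let $\mathbb{X}$ be a complex Banach space and let $T \in \mathbb{L}(\mathbb{X}, \mathbb{X}^* )$. Then the following hold: (i) For any nonisotropic vector $x \in \mathbb{X}$, $\perp_T$ is left symmetric at $x$ if and only if $\perp_T$ is right symmetric at $x$. (ii) If $T$ is bijective, then for any nonzero isotropic vector $x\in \mathbb{X}$, $\perp_T$ is left symmetric at $x$ if and only if $\perp_T$ is right symmetric at $x$.
   Context: $\mathbb{X}^*$ is the dual space of $\mathbb{X}$ and $\mathbb{L}(\mathbb{X},\mathbb{X}^* )$ is the set of all bounded linear operators from $\mathbb{X}$ to $\mathbb{X}^*$. Write $(Tx,y) = Tx(y)$. For $x,y\in\mathbb{X}$, $x \perp_T y$ means $(Tx,y)=0$. A vector $x$ is ($T$-)isotropic if $(Tx,x)=0$, and nonisotropic otherwise. The relation $\perp_T$ is left symmetric at $x$ if for each $y\in\mathbb{X}$, $x\perp_T y$ implies $y\perp_T x$; it is right symmetric at $x$ if for each $y\in\mathbb{X}$, $y\perp_T x$ implies $x\perp_T y$. *)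

(* Defs.v *)
From HB Require Import structures.
From mathcomp Require Import all_boot all_order all_algebra.
From mathcomp Require Import complex.
From mathcomp Require Import all_classical all_reals all_analysis.

Set Implicit Arguments.
Unset Strict Implicit.
Unset Printing Implicit Defensive.

Import Order.TTheory GRing.Theory Num.Theory.
Import numFieldNormedType.Exports.

Local Open Scope classical_set_scope.
Local Open Scope ring_scope.
Local Open Scope complex_scope.

Section BoundedLinear.
Context {R : realType} (X Y : normedModType R[i]).

Definition is_bounded_linear : {pred X -> Y} :=
  fun f => `[< linear f /\ bounded_near f (nbhs (0 : X)) >].

Record bounded_linear : Type := BoundedLinear {
  bounded_linear_fun :> X -> Y ;
  _ : bounded_linear_fun \in is_bounded_linear }.

Lemma is_bounded_linearP (f : X -> Y) :
  reflect (linear f /\ bounded_near f (nbhs (0 : X))) (f \in is_bounded_linear).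
Proof. exact: asboolP. Qed.

HB.instance Definition _ := [isSub for bounded_linear_fun].
HB.instance Definition _ := [Choice of bounded_linear by <:].

Lemma bounded_linear_linear (f : bounded_linear) : linear f.
Proof. by have /is_bounded_linearP[] := valP f. Qed.

HB.instance Definition _ (f : bounded_linear) :=
  GRing.isLinear.Build R[i] X Y *:%R f (bounded_linear_linear f).

Lemma bounded_linear_near (f : bounded_linear) :
  bounded_near f (nbhs (0 : X)).
Proof. by have /is_bounded_linearP[] := valP f. Qed.

Lemma is_bounded_linear_submod : submod_closed is_bounded_linear.
Proof.
split=> [|k f g].
  apply/is_bounded_linearP; split=> [a u v|]; first by rewrite scaler0 addr0.
  by apply/ex_bound; exists 0; apply: nearW => x /=; rewrite normr0.
move=> /is_bounded_linearP[lf /ex_bound[M bM]] /is_bounded_linearP[lg /ex_bound[N bN]].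
apply/is_bounded_linearP; split=> [a u v|].
  change (k *: f (a *: u + v) + g (a *: u + v) =
    a *: (k *: f u + g u) + (k *: f v + g v)).
  by rewrite lf lg !scalerDr !scalerA (mulrC a) addrACA.
apply/ex_bound; exists (`|k| * M + N); near=> x.
apply: (le_trans (ler_normD _ _)); rewrite lerD //; last by near: x.
by rewrite normrZ ler_wpM2l //; near: x.
Unshelve. all: by end_near. Qed.

HB.instance Definition _ := GRing.isSubmodClosed.Build R[i] (X -> Y)
  is_bounded_linear is_bounded_linear_submod.
HB.instance Definition _ :=
  [SubChoice_isSubLmodule of bounded_linear by <:].

(* The norms of X and Y take their (real nonnegative) values in R[i], whereas
   suprema exist in R only. *)
Definition opnorm (f : bounded_linear) : R[i] :=
  (sup [set complex.Re `|f x| | x in [set x : X | `|x| <= 1]])%:C.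

Let ReK (V : normedModType R[i]) (v : V) : (complex.Re `|v|)%:C = `|v|.
Proof. by rewrite RRe_real // normr_real. Qed.

Let has_sup_opnorm (f : bounded_linear) :
  has_sup [set complex.Re `|f x| | x in [set x : X | `|x| <= 1]].
Proof.
split; first by exists (complex.Re `|f 0|); exists 0 => //=; rewrite normr0.
have /bounded_funP/(_ 1)[M fM] := bounded_linear_near f.
exists (complex.Re M) => _ [x /= x1 <-].
rewrite -lecR ReK RRe_real ?fM //.
by rewrite ger0_real // (le_trans _ (fM 0 _)) ?normr0.
Qed.

Lemma opnorm_ge0 (f : bounded_linear) : 0 <= opnorm f.
Proof.
rewrite /opnorm -[0]/(0%:C) lecR; apply: ub_le_sup.
  by case: (has_sup_opnorm f).
by exists 0; rewrite /= ?raddf0 normr0.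
Qed.

Lemma le_opnorm (f : bounded_linear) (x : X) : `|f x| <= opnorm f * `|x|.
Proof.
have [->|x0] := eqVneq x 0; first by rewrite raddf0 !normr0 mulr0.
have nx : 0 < `|x| by rewrite normr_gt0.
rewrite -ler_pdivrMr // mulrC.
suff : `|f (`|x|^-1 *: x)| <= opnorm f by rewrite linearZ normrZ normfV normr_id.
rewrite /opnorm -ReK lecR; apply: ub_le_sup; first by case: (has_sup_opnorm f).
by exists (`|x|^-1 *: x) => //=; rewrite normrZ normfV normr_id mulVf // gt_eqF.
Qed.

Lemma opnorm_le (f : bounded_linear) (M : R[i]) :
  (forall x, `|x| <= 1 -> `|f x| <= M) -> opnorm f <= M.
Proof.
move=> fM; have M0 : 0 <= M by rewrite (le_trans _ (fM 0 _)) ?normr0.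
rewrite -[M]RRe_real ?ger0_real // lecR; apply: ge_sup.
  by case: (has_sup_opnorm f).
by move=> _ [x /= x1 <-]; rewrite -lecR ReK RRe_real ?ger0_real // fM.
Qed.

Let le_opnorm1 (f : bounded_linear) (x : X) : `|x| <= 1 -> `|f x| <= opnorm f.
Proof.
move=> x1; apply: (le_trans (le_opnorm f x)).
by rewrite ler_piMr // opnorm_ge0.
Qed.

Lemma opnormD (f g : bounded_linear) : opnorm (f + g) <= opnorm f + opnorm g.
Proof.
apply: opnorm_le => x x1; apply: (le_trans (ler_normD _ _)).
by rewrite lerD // le_opnorm1.
Qed.

Lemma opnormZ (k : R[i]) (f : bounded_linear) :
  opnorm (k *: f) = `|k| * opnorm f.
Proof.
have leZ l g : opnorm (l *: g) <= `|l| * opnorm g.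
  by apply: opnorm_le => x x1; rewrite [leLHS]normrZ ler_wpM2l // le_opnorm1.
apply/eqP; rewrite eq_le leZ /=; have [->|k0] := eqVneq k 0.
  by rewrite normr0 mul0r opnorm_ge0.
have := leZ k^-1 (k *: f).
by rewrite scalerA mulVf // scale1r normfV ler_pdivlMl // normr_gt0.
Qed.

Lemma opnorm_eq0 (f : bounded_linear) : opnorm f = 0 -> f = 0.
Proof.
move=> f0; apply/val_inj/funext => x /=; apply/eqP.
by rewrite -normr_le0 -[leRHS](mul0r `|x|) -f0 le_opnorm.
Qed.

HB.instance Definition _ := Lmodule_isNormed.Build R[i] bounded_linear
  opnormD opnormZ opnorm_eq0.

End BoundedLinear.

Definition dual {R : realType} (X : normedModType R[i]) : normedModType R[i] :=
  bounded_linear X R[i]^o.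

Section Orthogonality.
Context {R : realType} {X : normedModType R[i]} (T : bounded_linear X (dual X)).

Definition pairing (x y : X) : R[i] := (T x : bounded_linear X R[i]^o) y.

Definition perp (x y : X) : Prop := pairing x y = 0.

Definition isotropic (x : X) : Prop := pairing x x = 0.

Definition left_symmetric_at (x : X) : Prop := forall y, perp x y -> perp y x.

Definition right_symmetric_at (x : X) : Prop := forall y, perp y x -> perp x y.

End Orthogonality.

(* Main.v *)
Require Import Defs.
From mathcomp Require Import all_boot all_order all_algebra.
From mathcomp Require Import complex.
From mathcomp Require Import all_classical all_reals all_analysis.
Import GRing.Theory Num.Theory numFieldNormedType.Exports.
Local Open Scope ring_scope.
Local Open Scope complex_scope.

(** Both symmetries at [x] compare the kernels of the linear functionals
    [(Tx, -)] and [(T-, x)]. A kernel inclusion between linear functionals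
    reverses as soon as the one with the larger kernel is nonzero, so it
    suffices that both functionals be nonzero. If [x] is nonisotropic, neither
    vanishes at [x]. If [T] is bijective and [x] is nonzero, then [(Tx, z) != 0]
    for some [z]; the bounded functional [(T-, z)] is [Tu] for some [u], and
    [(Tu, x) = (Tx, z) != 0]. In particular Hahn-Banach is not needed. *)

Lemma scalar_ker_sub_sym {K : fieldType} {V : lmodType K} {f g : V -> K}
    {z : V} :
  scalar f -> scalar g -> g z <> 0 ->
  (forall y, f y = 0 -> g y = 0) -> forall y, g y = 0 -> f y = 0.
Proof.
move=> lf lg /eqP gz fg y gy; have fz : f z != 0.
  by apply/eqP => /fg; apply/eqP.
(* The multiple of [z] is chosen to move [y] into the kernel of [f], hence of [g]; as [g y = 0],
   this leaves [f y / f z * g z = 0]. *)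
have : f (- (f y / f z) *: z + y) = 0 by rewrite lf mulNr divfK // addNr.
move/fg; rewrite lg gy addr0 => /eqP.
by rewrite mulf_eq0 (negPf gz) orbF oppr_eq0 mulf_eq0 invr_eq0 (negPf fz) orbF
  => /eqP.
Qed.

Section Pairing.
Context {R : realType} {X : normedModType R[i]} (T : bounded_linear X (dual X)).

Lemma pairing_scalarr (x : X) : scalar (pairing T x).
Proof. by move=> a u v; rewrite /pairing linearP. Qed.

Lemma pairing_scalarl (y : X) : scalar (pairing T ^~ y).
Proof. by move=> a u v; rewrite /pairing linearP. Qed.

Lemma is_bounded_linear_pairingl (y : X) :
  (pairing T ^~ y : X -> R[i]^o) \in is_bounded_linear (Y := R[i]^o).
Proof.
apply/is_bounded_linearP; split; first exact: pairing_scalarl.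
have /ex_bound[M TM] := bounded_linear_near T.
(* Near 0 the operator norm of [T w] is at most [M], which bounds the value of [T w] at [y]. *)
apply/ex_bound; exists (M * `|y|).
apply: filterS TM => w Tw.
apply: Order.POrderTheory.le_trans (le_opnorm (T w) y) _.
exact: ler_wpM2r.
Qed.

Lemma pairing_neq0r {x : X} :
  injective T -> x <> 0 -> exists z, pairing T x z <> 0.
Proof.
move=> injT x0; apply: contrapT => /forallNP Tx0; apply: x0; apply: injT.
rewrite raddf0; apply/val_inj/funext => z /=.
by apply: contrapT; exact: Tx0.
Qed.

Lemma pairing_neq0l {x : X} :
  bijective T -> x <> 0 -> exists z, pairing T z x <> 0.
Proof.
move=> bijT /(pairing_neq0r (bij_inj bijT))[z xz].
have [S _ TK] := bijT.
(* The witness is the preimage under [T] of the functional [(T-, z)], whose value at [x] is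
   [(Tx, z)]. *)
exists (S (BoundedLinear (is_bounded_linear_pairingl z))).
by rewrite /pairing TK.
Qed.

Lemma left_right_symmetric_at {x u v : X} :
  pairing T x u <> 0 -> pairing T v x <> 0 ->
  left_symmetric_at T x <-> right_symmetric_at T x.
Proof.
move=> xu vx; split.
  exact: (scalar_ker_sub_sym (pairing_scalarr x) (pairing_scalarl x) vx).
exact: (scalar_ker_sub_sym (pairing_scalarl x) (pairing_scalarr x) xu).
Qed.

End Pairing.

Theorem theorem2p5 (R : realType) (X : completeNormedModType R[i])
    (T : bounded_linear X (dual X)) :
  (forall x : X, ~ isotropic T x ->
     (left_symmetric_at T x <-> right_symmetric_at T x)) /\
  (bijective T ->
   forall x : X, x <> 0 -> isotropic T x ->
     (left_symmetric_at T x <-> right_symmetric_at T x)).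
Proof.
split=> [x xx|bijT x x0 _]; first exact: (left_right_symmetric_at T xx xx).
have [u xu] := pairing_neq0r T (bij_inj bijT) x0.
have [v vx] := pairing_neq0l T bijT x0.
exact: (left_right_symmetric_at T xu vx).
Qed.
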